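(* Let $X$ be a non-empty locally connected completely regular space. Then $X$ has a completely regular one-point connectification if and only if no (connected) component of $X$ is compact.
   Context: Completely regular means completely regular and Hausdorff (i.e. Tychonoff). A space $X$ is locally connected if for every $x\in X$, every neighborhood of $x$ in $X$ contains a connected neighborhood of $x$ in $X$. A space $Y$ is an extension of a space $X$ if $Y$ contains $X$ as a dense subspace; it is a one-point extension if moreover $Y\setminus X$ is a singleton. A one-point connectification of $X$ is a one-point extension of $X$ that is connected. *)

(* Defs.v *)
From HB Require Import structures.
From mathcomp Require Import all_boot all_order all_algebra.
From mathcomp Require Import all_classical all_reals topology normedtype.

Set Implicit Arguments.
Unset Strict Implicit.
Unset Printing Implicit Defensive.

Import Order.TTheory GRing.Theory Num.Theory.
Import numFieldNormedType.Exports.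

Local Open Scope classical_set_scope.
Local Open Scope ring_scope.

(* The library's [completely_regular_space] separates points from closed sets
   through [uniform_separator], without mentioning the reals and without any
   separation axiom; this is the usual reading by real-valued functions. *)
Lemma completely_regular_spaceP (R : realType) (T : topologicalType) :
  completely_regular_space T <->
  forall (a : T) (B : set T), closed B -> ~ B a ->
    exists f : T -> R, [/\ continuous f, range f `<=` `[0, 1],
      f a = 0 & forall b, B b -> f b = 1].
Proof.
split=> [crT a B cB nBa|sepT a B cB nBa].
  have /(@uniform_separatorP _ R)[f [cf f01 fa fB]] := crT a B cB nBa.
  exists f; split => //; first by apply: fa; exists a.
  by move=> b Bb; apply: fB; exists b.
apply/(@uniform_separatorP _ R); have [f [cf f01 fa fB]] := sepT a B cB nBa.
by exists f; split => // _ [b /= + <-]; [move=> -> | exact: fB].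
Qed.

Definition tychonoff_space (T : topologicalType) : Prop :=
  completely_regular_space T /\ hausdorff_space T.

Definition locally_connected (T : topologicalType) : Prop :=
  forall (x : T) (U : set T), nbhs x U ->
    exists V : set T, [/\ nbhs x V, V `<=` U & connected V].

Definition embedding (X Y : topologicalType) (e : X -> Y) : Prop :=
  injective e /\
  forall A : set X, open A <-> exists2 B : set Y, open B & A = e @^-1` B.

(* The inclusion of [X] in the larger space [Y] is represented by an
   embedding [e]; the copy of [X] inside [Y] is [range e]. *)
Definition extension (X Y : topologicalType) (e : X -> Y) : Prop :=
  embedding e /\ dense (range e).

Definition one_point_extension (X Y : topologicalType) (e : X -> Y) : Prop :=
  extension e /\ exists p : Y, ~` range e = [set p].

Definition one_point_connectification (X Y : topologicalType) (e : X -> Y) :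
    Prop :=
  one_point_extension e /\ connected [set: Y].

(* Main.v *)
(** A filter without cluster points in a Tychonoff space [X] can be made to
    converge to a single new point: on the union of [X] and a point, take the
    initial topology of all continuous real functions on [X] vanishing on a
    member of the filter, extended by 0. When the components of [X] are open
    and none is compact, each component carries a proper filter without
    cluster points; the intersection of these filters has no cluster point
    either, and the point added at its limit adheres to every component, which
    makes the extension connected. Conversely, a compact component would be
    clopen in every Hausdorff one-point extension. *)
Require Import Defs.
From mathcomp Require Import all_boot all_order all_algebra.
From mathcomp Require Import all_classical all_reals topology normedtype.
From mathcomp Require Import Rstruct.
Local Open Scope classical_set_scope.

Lemma open_component (X : topologicalType) (x : X) :
  locally_connected X -> open (connected_component [set: X] x).
Proof.
move=> lcX; rewrite openE => y Cy.
have [V [nV _ cV]] := lcX y setT filterT.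
apply: (filterS _ nV); rewrite (same_connected_component Cy).
exact: (connected_component_max (nbhs_singleton nV)).
Qed.

(** Failure of compactness only excludes cluster points inside [C]; closedness of [C], a member of
    [F], excludes all others. *)
Lemma not_compact_filter (X : topologicalType) (C : set X) :
  closed C -> ~ compact C ->
  exists F : set_system X, [/\ ProperFilter F, F C & cluster F = set0].
Proof.
move=> cC; rewrite /compact => /existsNP[F /not_implyP[PF /not_implyP[FC nc]]].
exists F; split => //; rewrite -subset0 => x clx; apply: nc; exists x.
by split => //; move: clx; rewrite clusterE => /(_ _ FC); rewrite -(closure_id C).1.
Qed.

Lemma not_clusterP (X : topologicalType) (F : set_system X) (x : X) :
  Filter F -> ~ cluster F x -> exists2 W, nbhs x W & F (~` W).
Proof.
move=> FF /existsNP[A /existsNP[W /not_implyP[FA /not_implyP[nW AW]]]].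
exists W => //; apply: filterS FA => y Ay Wy; apply: AW; by exists y.
Qed.

Section point_at_filter.
Context {R : realType} {X : topologicalType} (G : set_system X).
Context {FG : ProperFilter G}.
Import GRing.Theory Num.Theory numFieldNormedType.Exports.
Local Open Scope ring_scope.

Let funs := {f : X -> R | continuous f /\ G (f @^-1` [set 0])}.
Let ext (f : funs) : option X -> R := oapp (sval f) 0.

(** The initial topology is built as a supremum of uniform structures, so that complete regularity
    follows from uniformizability. *)
Definition point_at_filter : uniformType :=
  @sup_topology (option X) funs
    (fun f => Uniform.class (initial_topology (ext f))).

Local Notation Y := point_at_filter.
Let e : X -> Y := Some.
Let p : Y := None.

Lemma point_at_filter_cvg : e @ G --> p.
Proof.
apply/cvg_sup => f U [/= _ [[V /= oV <-] /= Vp]] /filterS; apply.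
rewrite nbhs_filterE; have [_ Gf] := svalP f.
by apply: (@filterS _ G _ _ _ _ Gf) => x /= ->.
Qed.

Lemma point_at_filter_continuous : continuous e.
Proof.
move=> x; apply/cvg_sup => f U [/= _ [[V /= oV <-] /= Vp]] /filterS; apply.
have [cf _] := svalP f; apply: cf; exact: open_nbhs_nbhs.
Qed.

Lemma ext_continuous (f : funs) : continuous (ext f : Y -> R).
Proof.
move=> y V nV.
have /cvg_sup/(_ f) : nbhs (y : Y) --> y by exact: cvg_id.
by apply; exact: (@initial_continuous _ _ (ext f) y V nV).
Qed.

Hypotheses (tychX : tychonoff_space X) (clG : cluster G = set0).

Lemma point_at_filter_separator (A : set X) (a : X) : open A -> A a ->
  exists f : funs, [/\ sval f a = 1 & forall x, ~ A x -> sval f x = 0].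
Proof.
move=> oA Aa.
have [W nW GW] : exists2 W, nbhs a W & G (~` W).
  by apply: not_clusterP; rewrite clG.
have oAW : open (A `&` W°) by apply: openI => //; exact: open_interior.
have [f [cf _ fa fB]] := (completely_regular_spaceP R X).1 tychX.1 a _
  (open_closedC oAW) (fun n => n (conj Aa nW)).
have cg : continuous (fun x => 1 - f x).
  by move=> x; apply: cvgB; [exact: cvg_cst|exact: cf].
have Gg : G ((fun x => 1 - f x) @^-1` [set 0]).
  apply: filterS GW => x nWx /=; rewrite fB ?subrr// => -[_ /interior_subset].
  exact: nWx.
unshelve eexists; first exact: (exist _ (fun x => 1 - f x) (conj cg Gg)).
split => [|x nAx] /=; first by rewrite fa subr0.
by rewrite fB ?subrr// => -[].
Qed.

Lemma point_at_filter_embedding : embedding e.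
Proof.
split=> [x y [->] //|A]; split=> [oA|[B oB ->]]; last first.
  by move/continuousP : point_at_filter_continuous; exact.
(* The witness is the union of the non-vanishing sets of the extended functions that are zero off
   [A]. *)
exists (\bigcup_(f in [set f : funs | forall x, ~ A x -> sval f x = 0])
   (ext f @^-1` [set~ 0])).
  apply: bigcup_open => f _; move/continuousP: (@ext_continuous f); apply.
  exact/closed_openC/closed_eq.
apply/seteqP; split=> [a Aa|a [f /= f0 fa]].
  have [f [fa f0]] := point_at_filter_separator _ _ oA Aa.
  by exists f => //=; rewrite fa; apply/eqP; exact: oner_neq0.
by apply: contrapT => /f0.
Qed.

Lemma point_at_filter_extension : one_point_extension e /\ ~` range e = [set p].
Proof.
have rp : ~` range e = [set p].
  apply/seteqP; split=> [[x|] //|_ -> [] //].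
  by move=> /= nx; exfalso; apply: nx; exists x.
split => //; split; last by exists p.
split; first exact: point_at_filter_embedding.
(* An open set around the new point meets [range e] because [G] converges to that point. *)
move=> B [[x|] By] oB; first by exists (e x); split => //; exists x.
have /filter_ex[x Bx] : G (e @^-1` B).
  by apply: point_at_filter_cvg; exact: open_nbhs_nbhs.
by exists (e x); split => //; exists x.
Qed.

Lemma point_at_filter_tychonoff : tychonoff_space Y.
Proof.
split; first exact: (@uniform_completely_regular R).
(* Of two distinct points of [Y] at least one comes from [X], and distinct values of a continuous
   real function give disjoint neighborhoods. *)
suff sep (x : X) (y : Y) : e x <> y -> exists f : funs, ext f (e x) <> ext f y.
  move=> y z clyz; apply: contrapT => yz.
  have [f] : exists f : funs, ext f y <> ext f z.
    move: y z yz {clyz} => [x|] [x'|] // xy; try exact: sep.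
    by have [|f /nesym ?] := sep x' None; [|exists f].
  apply; apply: (@Rhausdorff R) => A B nA nB.
  have [t [At Bt]] :=
    clyz _ _ (@ext_continuous f _ _ nA) (@ext_continuous f _ _ nB).
  by exists (ext f t).
move=> xy; case: y xy => [y|] xy.
  have oy : open (~` [set y]).
    apply/closed_openC/accessible_closed_set1/hausdorff_accessible; exact: tychX.2.
  have [|f [fx f0]] := point_at_filter_separator _ x oy.
    by move=> yx; apply: xy; rewrite yx.
  exists f => /=; rewrite fx f0; first exact/eqP/oner_neq0.
  by apply.
have [//|f [fx _]] := point_at_filter_separator _ x openT.
exists f => /=; rewrite fx; exact/eqP/oner_neq0.
Qed.

End point_at_filter.

(** The image of a compact component is closed in [Y], and open because [range e] is the complement
    of a point. By connectedness it would be all of [Y], yet it misses [p]. *)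
Lemma compact_component_not_connectification (X Y : topologicalType)
    (e : X -> Y) (x : X) :
  locally_connected X -> one_point_connectification e -> hausdorff_space Y ->
  ~ compact (connected_component [set: X] x).
Proof.
move=> lcX [[[[ie eo] _] [p rp]] cY] hY cC.
have ce : continuous e by apply/continuousP => B oB; apply/eo; exists B.
have cl : closed (e @` connected_component [set: X] x).
  apply: compact_closed => //; apply: continuous_compact => //.
  exact: continuous_subspaceT.
have orng : open (range e).
  rewrite -[range e]setCK rp; apply: closed_openC.
  exact/accessible_closed_set1/hausdorff_accessible.
have op : open (e @` connected_component [set: X] x).
  have [B oB CB] := (eo _).1 (open_component _ x lcX).
  suff -> : e @` connected_component [set: X] x = B `&` range e by exact: openI.
  rewrite CB; apply/seteqP; split=> [_ [y By <-]|z [Bz [y _ eyz]]].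
    by split => //; exists y.
  by exists y; rewrite /= ?eyz.
have eT : e @` connected_component [set: X] x = setT.
  apply: cY.
  - by exists (e x), x => //; exact: connected_component_refl.
  - by eexists; [exact: op|rewrite setTI].
  - by eexists; [exact: cl|rewrite setTI].
have : (~` range e) p by rewrite rp.
apply; have : [set: Y] p by [].
by rewrite -eT => -[y _ <-]; exists y.
Qed.

(** The closures of the images of the components are connected, share [p] and cover [Y]. *)
Lemma adherent_component_connected (X Y : topologicalType) (e : X -> Y) (p : Y) :
  continuous e -> ~` range e = [set p] ->
  (forall x : X, closure (e @` connected_component [set: X] x) p) ->
  [set: X] !=set0 -> connected [set: Y].
Proof.
move=> ce rp clp [x0 _].
suff -> : [set: Y] =
    \bigcup_(x in [set: X]) closure (e @` connected_component [set: X] x).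
  apply: bigcup_connected => [|x _]; first by exists p.
  apply/connected_closure/connected_continuous_connected.
    exact: component_connected.
  exact: continuous_subspaceT.
apply/seteqP; split=> // y _.
have [[x _ <-]|] := pselect (range e y).
  exists x => //; apply: subset_closure; exists x => //.
  exact: connected_component_refl.
by move=> ney; have : (~` range e) y by []; rewrite rp => ->; exists x0.
Qed.

Lemma components_filter (X : topologicalType) : [set: X] !=set0 ->
  locally_connected X ->
  (forall x : X, ~ compact (connected_component [set: X] x)) ->
  exists G : set_system X, [/\ ProperFilter G, cluster G = set0 &
    forall x A, G A -> connected_component [set: X] x `&` A !=set0].
Proof.
move=> [x0 _] lcX ncX.
(* Filters are chosen for sets rather than points, so that all points of one component receive the
   same filter. Sets that are not components get the dummy value [setT]. *)
have /choice[U PU] (C : set X) : exists F : set_system X,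
    (exists x, C = connected_component [set: X] x) ->
    [/\ ProperFilter F, F C & cluster F = set0].
  have [[x ->]|nC] := pselect (exists x, C = connected_component [set: X] x).
    have [F PF] := not_compact_filter _ _ (component_closed closedT) (ncX x).
    by exists F.
  by exists setT.
pose V x := U (connected_component [set: X] x).
have {}PU x : [/\ ProperFilter (V x), V x (connected_component [set: X] x)
    & cluster (V x) = set0] by apply: PU; exists x.
have meet x A : V x A -> connected_component [set: X] x `&` A !=set0.
  by have [PV VC _] := PU x => VA; exact: filter_ex (filterI VC VA).
exists [set A | forall x, V x A]; split.
- split; first by move=> /(_ x0) /meet[x []].
  split=> [x|A B VA VB x|A B AB VA x]; have [PV _ _] := PU x.
  + exact: filterT.
  + exact: filterI.
  + exact: filterS (VA x).
- rewrite -subset0 => a cla.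
  have [PVa Va cla0] := PU a.
  have [W nW VW] : exists2 W, nbhs a W & V a (~` W).
    by apply: not_clusterP; rewrite cla0.
  have nC : nbhs a (connected_component [set: X] a).
    apply: open_nbhs_nbhs; split; first exact: open_component.
    exact: connected_component_refl.
  suff VC x : V x (~` (W `&` connected_component [set: X] a)).
    by have [y []] := cla _ _ VC (filterI nW nC).
  have [ax|ax] := pselect (connected_component [set: X] a x).
    rewrite /V -(same_connected_component ax); apply: filterS VW.
    by move=> y nWy [].
  have [PV VC _] := PU x; apply: filterS VC => y xy [_ ay]; apply: ax.
  by apply: connected_component_trans ay _; exact: connected_component_sym.
- by move=> x A /(_ x) /meet.
Qed.

Theorem theorem2p2 (X : topologicalType) (X_neq0 : [set: X] !=set0)
    (X_lc : locally_connected X) (X_tych : tychonoff_space X) :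
  (exists (Y : topologicalType) (e : X -> Y),
     one_point_connectification e /\ tychonoff_space Y) <->
  (forall x : X, ~ compact (connected_component [set: X] x)).
Proof.
split=> [[Y [e [eY [_ hY]]]] x|ncX].
  exact: compact_component_not_connectification eY hY.
have [G [PG clG meetG]] := components_filter _ X_neq0 X_lc ncX.
pose Y := @point_at_filter Rdefinitions.R X G; pose e : X -> Y := Some.
have [Ye rp] := @point_at_filter_extension Rdefinitions.R X G PG X_tych clG.
exists Y, e; split; last exact: point_at_filter_tychonoff.
split=> //; apply: adherent_component_connected rp _ X_neq0.
  exact: point_at_filter_continuous.
(* The trace on [X] of a neighborhood of the new point lies in [G], hence meets every component. *)
move=> x B nB.
have [y [Cy By]] := meetG x _ (point_at_filter_cvg _ _ nB).
by exists (e y); split => //; exists y.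
Qed.
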